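(* Let $d\ge 1$ be an integer. For every $N\in\mathbb{Z}_{\ge 0}$, $$g_d(N)=\sum_{j=0}^{d-1}\binom{N+2d-2-j}{2d-2}=\binom{N+2d-1}{2d-1}-\binom{N+d-1}{2d-1}.$$
   Context: Let $[d]=\{1,\dots,d\}$. A matrix $A\in\mathbb{R}^{d\times d}$ is a $G$-matrix of value $N\in\mathbb{R}_{\ge 0}$ if all its entries are nonnegative and $A_{1,\sigma(1)}+A_{2,\sigma(2)}+\cdots+A_{d,\sigma(d)}=N$ for every permutation $\sigma$ of $[d]$. For $N\in\mathbb{Z}_{\ge 0}$, $g_d(N)$ denotes the number of $d\times d$ $G$-matrices of value $N$ all of whose entries are integers. As usual $\binom{n}{k}=0$ for integers $0\le n<k$. *)

(* Defs.v *)
From HB Require Import structures.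
From mathcomp Require Import all_boot all_order all_fingroup all_algebra.
From mathcomp Require Import finmap.
From mathcomp Require Import boolp classical_sets functions cardinality reals.

Set Implicit Arguments.
Unset Strict Implicit.
Unset Printing Implicit Defensive.

Import Order.TTheory GRing.Theory Num.Theory.

Local Open Scope classical_set_scope.
Local Open Scope ring_scope.

Definition G_matrix (R : realType) (d : nat) (A : 'M[R]_d) (v : R) : Prop :=
  [/\ 0 <= v,
      forall i j : 'I_d, 0 <= A i j &
      forall s : 'S_d, \sum_(i < d) A i (s i) = v].

Definition integral_G_matrices (R : realType) (d N : nat) : set 'M[R]_d :=
  [set A | G_matrix A N%:R /\ forall i j : 'I_d, A i j \is a Num.int].

(* [fset_set] sends an infinite set to the empty one, but the set counted here
   is always finite: every entry lies on some permutation, so it is at most N. *)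
Definition g (R : realType) (d N : nat) : nat :=
  #|` fset_set (@integral_G_matrices R d N)|%fset.

(* Main.v *)
Require Import Defs.
From mathcomp Require Import all_boot all_order all_fingroup all_algebra.
From mathcomp Require Import finmap.
From mathcomp Require Import classical_sets cardinality reals zify.

(** The permutation condition forces [A i j + A k l = A i l + A k j] (compare two
permutations differing by a transposition), so [A i j = a i + b j] with
nonnegative integers [a i], [b j]; this is unique once [min a = 0], and the
value of [A] is the total sum of [a] and [b]. Hence [g_d(N)] is the number of
compositions of [N] into [2d] nonnegative parts whose first [d] parts are not
all positive; subtracting 1 from each of these [d] parts counts the excluded
compositions, and the hockey-stick identity turns the difference of the two
binomials into the sum. *)

Set Implicit Arguments.
Unset Strict Implicit.
Unset Printing Implicit Defensive.

Import Order.TTheory GRing.Theory Num.Theory.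

Local Open Scope nat_scope.

(** Stars and bars: an enumeration of [T] turns these functions into the tuples counted by
    [card_ord_partitions]. Bounding the values by [n] loses nothing, as no part exceeds the
    total. *)
Lemma card_ffun_sum (T : finType) (m n : nat) : #|T| = m.+1 ->
  #|[set f : {ffun T -> 'I_n.+1} | \sum_x f x == n]%SET| = 'C(m + n, m).
Proof.
move=> cardT; rewrite -card_ord_partitions.
pose e (i : 'I_m.+1) : T := enum_val (cast_ord (esym cardT) i).
pose r (x : T) : 'I_m.+1 := cast_ord cardT (enum_rank x).
have rK : cancel r e by move=> x; rewrite /e /r cast_ordK enum_rankK.
have eK : cancel e r by move=> i; rewrite /e /r enum_valK cast_ordKV.
pose F (f : {ffun T -> 'I_n.+1}) := [tuple f (e i) | i < m.+1].
have F_inj : injective F.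
  move=> f f' /(congr1 (fun t => tnth t)) eqF; apply/ffunP => x.
  by have := congr1 (fun t => t (r x)) eqF; rewrite !tnth_mktuple rK.
rewrite -(card_imset _ F_inj); apply: eq_card => t; rewrite !inE.
have sumF f : \sum_(i <- F f) i = \sum_x f x.
  rewrite big_tuple (reindex e) /=; last by exists r => ? _.
  by apply: eq_bigr => i _; rewrite tnth_mktuple.
apply/imsetP/idP => [[f]|sumt].
  by rewrite inE => sumf ->; rewrite sumF.
have tE : t = F [ffun x => tnth t (r x)].
  by apply: eq_from_tnth => i; rewrite tnth_mktuple ffunE eK.
by exists [ffun x => tnth t (r x)] => //; rewrite inE -sumF -tE.
Qed.

(* [0 < m] is needed: for [m = n = 0] and [#|A| = 1], the truncated
   subtraction would make the right-hand side 1 instead of 0. *)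
Lemma card_ffun_sum_gt0 (T : finType) (A : pred T) (m n : nat) :
  #|T| = m.+1 -> 0 < m ->
  #|[set f : {ffun T -> 'I_n.+1} |
      (\sum_x f x == n) && [forall x in A, 0 < f x]]%SET| =
  'C(m + n - #|A|, m).
Proof.
move=> cardT m_gt0.
have sumA : \sum_x (x \in A : nat) = #|A| 
  by rewrite -sum1_card [RHS]big_mkcond; apply: eq_bigr => x _; case: (x \in A).
have [leAn|ltnA] := leqP #|A| n; last first.
  rewrite bin_small; last by lia.
  apply/eqP; rewrite cards_eq0; apply/eqP/setP => f; rewrite !inE.
  apply/negP => /andP[/eqP sumf /forall_inP f_gt0].
  suff : #|A| <= n by lia.
  rewrite -sumf -sumA; apply: leq_sum => x _.
  by case: (boolP (x \in A)) => [/f_gt0|].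
rewrite -addnBA // -(card_ffun_sum (n - #|A|) cardT).
(* Adding 1 on [A] maps the functions of sum [n - #|A|] bijectively onto those counted. Values stay
   at most [n]: where 1 is added, [A] is nonempty. *)
pose F (f : {ffun T -> 'I_(n - #|A|).+1}) : {ffun T -> 'I_n.+1} :=
  [ffun x => inord (f x + (x \in A))].
have FE f x : F f x = f x + (x \in A) :> nat.
  rewrite ffunE inordK //; have := ltn_ord (f x).
  have [xA|_] := boolP (x \in A); last by lia.
  have : 0 < #|A| by apply/card_gt0P; exists x.
  by move: leAn => /=; lia.
have F_inj : injective F.
  move=> f f' eqF; apply/ffunP => x; apply: val_inj => /=.
  have := congr1 val (congr1 (fun h : {ffun _ -> _} => h x) eqF).
  by rewrite /= !FE => /addIn.
rewrite -(card_imset _ F_inj); apply: eq_card => h; rewrite !inE.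
apply/andP/imsetP => [[/eqP sumh /forall_inP h_gt0]|[f]].
  have leAh x : (x \in A) <= h x by case: (boolP (x \in A)) => [/h_gt0|].
  have sumB : \sum_x (h x - (x \in A)) = n - #|A|.
    by rewrite sumnB ?sumh ?sumA // => x _; exact: leAh.
  have bnd x : h x - (x \in A) < (n - #|A|).+1.
    by rewrite ltnS -sumB (bigD1 x) //= leq_addr.
  exists [ffun x => Ordinal (bnd x)].
    rewrite inE; apply/eqP; rewrite -[RHS]sumB.
    by apply: eq_bigr => x _; rewrite ffunE.
  apply/ffunP => x; apply: val_inj => /=; by rewrite FE ffunE /= subnK ?leAh.
rewrite inE => /eqP sumf ->; split.
  under eq_bigr => x _ do rewrite FE.
  by rewrite big_split /= sumf sumA subnK.
by apply/forall_inP => x xA; rewrite FE xA addn1.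
Qed.

(** Hockey-stick identity: Pascal's rule makes the sum telescope. The remainder is added on the left
    to avoid truncated subtraction. *)
Lemma sum_bin_downward (M k e : nat) : e <= M.+1 ->
  \sum_(0 <= j < e) 'C(M - j, k) + 'C(M.+1 - e, k.+1) = 'C(M.+1, k.+1).
Proof.
elim: e => [|e IHe] le_eM; first by rewrite big_nil subn0.
rewrite big_nat_recr //= -(IHe (ltnW le_eM)) -addnA; congr (_ + _).
by rewrite subSS subSn // binS addnC.
Qed.

Local Open Scope ring_scope.

Lemma G_matrix_exchange (R : realType) (d : nat) (A : 'M[R]_d) (v : R) :
  G_matrix A v -> forall i j k l, A i j + A k l = A i l + A k j.
Proof.
case=> _ _ sumA i j k l.
have [<-|neq_ik] := eqVneq i k; first by rewrite addrC.
have [<-//|neq_jl] := eqVneq j l.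
(* A permutation with [i] sent to [j] and [k] to [l]: the second factor corrects the image of [k]
   and fixes [j], which differs from both points it swaps. *)
pose s : 'S_d := (tperm i j * tperm (tperm i j k) l)%g.
have si : s i = j.
  rewrite permM tpermL [LHS]tpermD // 1?eq_sym //.
  by rewrite -[X in X == _](tpermL i j) (inj_eq perm_inj).
have sk : s k = l by rewrite permM tpermL.
(* The two permutations differ only at [i] and [k], so all other summands cancel. *)
clearbody s; have := etrans (sumA (tperm i k * s)%g) (esym (sumA s)).
rewrite (bigD1 i) // (bigD1 k) 1?eq_sym //= [RHS](bigD1 i) //.
rewrite [in RHS](bigD1 k) 1?eq_sym //=.
rewrite !permM tpermL tpermR si sk.
rewrite (eq_bigr (fun x => A x (s x))) => [|x /andP[xi xk]].
  by rewrite !addrA => /addIr.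
by rewrite permM tpermD // eq_sym.
Qed.

(* [f \o inl] is the row potential [a], [f \o inr] the column potential [b]. *)
Definition sum_matrix (R : realType) (d N : nat)
    (f : {ffun 'I_d + 'I_d -> 'I_N.+1}) : 'M[R]_d :=
  \matrix_(i, j) (f (inl i) + f (inr j))%:R.

(** A zero among the row potentials rules out the shifts [(a + c, b - c)], which give the same
    matrix. *)
Definition reduced_potentials (d N : nat) :
    {set {ffun 'I_d + 'I_d -> 'I_N.+1}} :=
  [set f : {ffun 'I_d + 'I_d -> 'I_N.+1} |
    (\sum_x f x == N)%N && [exists i, f (inl i) == ord0]]%SET.

Lemma sum_matrix_inj (R : realType) (d N : nat) :
  {in reduced_potentials d N &, injective (@sum_matrix R d N)}.
Proof.
move=> f f'; rewrite !inE => /andP[_ /existsP[i /eqP fi]].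
move=> /andP[_ /existsP[i' /eqP fi']] eqM.
have eqE k l : (f (inl k) + f (inr l) = f' (inl k) + f' (inr l))%N.
  by have /matrixP/(_ k l)/eqP := eqM; rewrite !mxE eqr_nat => /eqP.
have fi0 : f (inl i) = 0%N :> nat by rewrite fi.
have fi0' : f' (inl i') = 0%N :> nat by rewrite fi'.
(* Row [i], where [f] vanishes, shows that [f (inr l)] is at least [f' (inr l)]; row [i'] gives the
   converse. *)
have eq_inr l : f (inr l) = f' (inr l) :> nat.
  apply/eqP; have := eqE i l; have := eqE i' l; rewrite fi0 fi0' !add0n => e' e.
  by rewrite eqn_leq {2}e -{1}e' !leq_addl.
apply/ffunP => -[] x; apply: val_inj => //=.
by have := eqE x x; rewrite eq_inr => /addIn.
Qed.

Lemma integral_G_matricesE (R : realType) (d N : nat) : (0 < d)%N ->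
  @integral_G_matrices R d N =
  [set` [fset sum_matrix R f | f in reduced_potentials d N]%fset]%classic.
Proof.
case: d => // d _; apply/seteqP; split=> A /=.
  move=> [GA intA]; have exch := G_matrix_exchange GA.
  case: GA => _ A_ge0 sumA.
  pose B i j := Num.truncn (A i j).
  have AB i j : A i j = (B i j)%:R.
    by rewrite truncnK // -intrEge0.
  have Bexch i j k l : (B i j + B k l = B i l + B k j)%N.
    by apply/eqP; rewrite -(eqr_nat R) !natrD -!AB exch.
  (* Row [i0] serves as the column potential. Its minimality in column [ord0] keeps the subtraction
     in [p] from truncating, and [p (inl i0)] is 0. *)
  have [i0 _ minB] := arg_minnP (fun i => B i ord0) (isT : xpredT (@ord0 d)).
  pose p (x : 'I_d.+1 + 'I_d.+1) :=
    match x with inl i => (B i ord0 - B i0 ord0)%N | inr j => B i0 j end.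
  have pE i j : (p (inl i) + p (inr j) = B i j)%N.
    by rewrite /p; have := Bexch i ord0 i0 j; have := minB i isT; lia.
  (* The total of the potentials is the trace, the sum along the identity permutation. *)
  have sump : (\sum_x p x = N)%N.
    rewrite big_sumType /= -big_split /=.
    apply/eqP; rewrite -(eqr_nat R) -(sumA 1%g) natr_sum; apply/eqP.
    by apply: eq_bigr => i _; rewrite perm1 AB -[in RHS]pE.
  have bnd x : (p x < N.+1)%N by rewrite ltnS -sump (bigD1 x) //= leq_addr.
  apply/imfsetP; exists [ffun x => Ordinal (bnd x)] => /=.
    rewrite inE; apply/andP; split.
      apply/eqP; rewrite -[RHS]sump.
      by apply: eq_bigr => x _; rewrite ffunE.
    by apply/existsP; exists i0; rewrite ffunE -val_eqE /= subnn.
  by apply/matrixP => i j; rewrite mxE !ffunE AB -pE.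
case/imfsetP=> f /=; rewrite inE => /andP[/eqP sumf _] ->.
split; last by move=> i j; rewrite mxE intr_nat // natr_nat.
split=> [|i j|s]; rewrite ?mxE ?ler0n //.
rewrite -[in RHS]sumf big_sumType natrD !natr_sum /=.
rewrite [X in _ = _ + X](reindex_inj (@perm_inj _ s)) -big_split /=.
by apply: eq_bigr => i _; rewrite mxE natrD.
Qed.

Lemma card_reduced_potentials (d N : nat) : (0 < d)%N ->
  (#|reduced_potentials d N| + 'C(N + d - 1, 2 * d - 1) =
   'C(N + 2 * d - 1, 2 * d - 1))%N.
Proof.
move=> d_gt0.
pose S := [set f : {ffun 'I_d + 'I_d -> 'I_N.+1} | \sum_x f x == N]%N%SET.
pose Z := [set f : {ffun 'I_d + 'I_d -> 'I_N.+1} |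
  [exists i, f (inl i) == ord0]]%SET.
pose A : pred ('I_d + 'I_d) := fun x => if x is inl _ then true else false.
have cardT : #|{: 'I_d + 'I_d}| = (2 * d - 1).+1.
  by rewrite card_sum !card_ord; lia.
have cardA : #|A| = d.
  rewrite -sum1_card big_mkcond big_sumType /= big1_eq addn0.
  by rewrite sum1_card card_ord.
rewrite [in RHS](_ : (N + 2 * d - 1 = 2 * d - 1 + N)%N); last by lia.
(* Within [S], the members of [Z] are the reduced potentials; the others are positive on [A], the
   row indices. *)
rewrite -(card_ffun_sum N cardT) -(cardsID Z S); congr (_ + _)%N.
  by apply: eq_card => f; rewrite !inE.
rewrite (_ : (N + d - 1 = 2 * d - 1 + N - #|A|)%N); last by rewrite cardA; lia.
rewrite -(card_ffun_sum_gt0 A N cardT); last by lia.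
apply: eq_card => f; rewrite !inE andbC negb_exists; congr (_ && _).
apply/forall_inP/forallP => [f_gt0 i|f_gt0 [i _|//]].
  by rewrite -val_eqE -lt0n f_gt0.
by have := f_gt0 i; rewrite -val_eqE -lt0n.
Qed.

Theorem mainTheorem5 (R : realType) (d : nat) (hd : (1 <= d)%N) (N : nat) :
  g R d N = (\sum_(0 <= j < d) 'C(N + 2 * d - 2 - j, 2 * d - 2))%N
  /\
  ((\sum_(0 <= j < d) 'C(N + 2 * d - 2 - j, 2 * d - 2))%N)%:Z
    = ('C(N + 2 * d - 1, 2 * d - 1))%:Z - ('C(N + d - 1, 2 * d - 1))%:Z.
Proof.
have gE : g R d N = #|reduced_potentials d N|.
  rewrite /g integral_G_matricesE // set_fsetK card_in_imfset /=; last first.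
    exact: sum_matrix_inj.
  by rewrite -cardE.
have sumE : (\sum_(0 <= j < d) 'C(N + 2 * d - 2 - j, 2 * d - 2) +
    'C(N + d - 1, 2 * d - 1) = 'C(N + 2 * d - 1, 2 * d - 1))%N.
  (* The side condition becomes [d <= N + 2 * d - 1], which holds since [d] is positive. *)
  have := @sum_bin_downward (N + 2 * d - 2) (2 * d - 2) d.
  have -> : ((N + 2 * d - 2).+1 = N + 2 * d - 1)%N by lia.
  have -> : ((2 * d - 2).+1 = 2 * d - 1)%N by lia.
  have -> : (N + 2 * d - 1 - d = N + d - 1)%N by lia.
  by apply; lia.
split; last by rewrite -sumE PoszD addrK.
apply/eqP; rewrite gE -(eqn_add2r 'C(N + d - 1, 2 * d - 1)) sumE.
by rewrite card_reduced_potentials.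
Qed.
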